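(* There is a $\mathcal{BC}c$-formula $\varphi$ such that, for every $n\geq 2$, $\varphi$ is satisfiable over $\mathrm{RC}(\mathbb{R}^n)$, but no interpretation over $\mathrm{RC}(\mathbb{R}^n)$ in which every variable is assigned a region with finitely many connected components satisfies $\varphi$.
   Context: For a topological space $T$ and $X\subseteq T$, $\overline{X}$ is the closure and $X^\circ$ the interior of $X$; $X$ is regular closed if $X=\overline{X^\circ}$. $\mathrm{RC}(T)$ is the set of regular closed subsets of $T$ (''regions''); it is a Boolean algebra with $X+Y=X\cup Y$, $X\cdot Y=\overline{(X\cap Y)^\circ}$, $-X=\overline{T\setminus X}$, $0=\emptyset$, $1=T$. Terms are built from countably many variables $r_1,r_2,\dots$ and the constants $0,1$ using $+,\cdot,-$. $\mathcal{BC}c$-formulas are built from atomic formulas $\tau_1=\tau_2$, $C(\tau_1,\tau_2)$ and $c(\tau)$ (for terms $\tau,\tau_1,\tau_2$) using $\wedge$ and $\neg$. An interpretation $\mathfrak I$ over $\mathrm{RC}(T)$ assigns to each variable an element of $\mathrm{RC}(T)$ and is extended to terms via the Boolean operations above; $\mathfrak I\models\tau_1=\tau_2$ iff $\tau_1^{\mathfrak I}=\tau_2^{\mathfrak I}$; $\mathfrak I\models C(\tau_1,\tau_2)$ iff $\tau_1^{\mathfrak I}\cap\tau_2^{\mathfrak I}\neq\emptyset$; $\mathfrak I\models c(\tau)$ iff $\tau^{\mathfrak I}$ is a connected subset of $T$; Boolean connectives are interpreted as usual. A formula is satisfiable over $\mathrm{RC}(T)$ if some interpretation over $\mathrm{RC}(T)$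 satisfies it. *)

(* Defs.v *)
From HB Require Import structures.
From mathcomp Require Import all_boot all_order all_algebra.
From mathcomp Require Import all_classical all_reals all_analysis.

Set Implicit Arguments.
Unset Strict Implicit.
Unset Printing Implicit Defensive.

Local Open Scope classical_set_scope.

Inductive term : Type :=
| Var of nat
| Zero
| One
| Add of term & term
| Mul of term & term
| Opp of term.

Inductive formula : Type :=
| Eq of term & term
| Contact of term & term
| Conn of term
| And of formula & formula
| Not of formula.

Section Semantics.
Variable T : topologicalType.
Implicit Types (X Y : set T) (I : nat -> set T).

Definition RC : set (set T) := [set X | regclosed X].

Definition rc_add X Y : set T := X `|` Y.
Definition rc_mul X Y : set T := closure ((X `&` Y)°).
Definition rc_opp X : set T := closure (~` X).

Definition interpretation I : Prop := forall i, RC (I i).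

Fixpoint term_val I (t : term) : set T :=
  match t with
  | Var i => I i
  | Zero => set0
  | One => setT
  | Add t1 t2 => rc_add (term_val I t1) (term_val I t2)
  | Mul t1 t2 => rc_mul (term_val I t1) (term_val I t2)
  | Opp t1 => rc_opp (term_val I t1)
  end.

(* The empty region is [connected] in the library's sense. *)
Fixpoint sat I (f : formula) : Prop :=
  match f with
  | Eq t1 t2 => term_val I t1 = term_val I t2
  | Contact t1 t2 => term_val I t1 `&` term_val I t2 !=set0
  | Conn t => connected (term_val I t)
  | And f1 f2 => sat I f1 /\ sat I f2
  | Not f1 => ~ sat I f1
  end.

Definition satisfiable (f : formula) : Prop :=
  exists I, interpretation I /\ sat I f.

Definition components X : set (set T) :=
  [set connected_component X x | x in X].

Definition finitely_many_components X : Prop := finite_set (components X).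

Lemma term_val_RC I t : interpretation I -> RC (term_val I t).
Proof.
move=> RCI; elim: t => [i|||t1 IH1 t2 IH2|t1 IH1 t2 IH2|t IH] /=.
- exact: RCI.
- by rewrite /RC /= /regclosed interior0 closure0.
- by rewrite /RC /= /regclosed interiorT closureT.
- rewrite /RC /rc_add /= /regclosed; apply/seteqP; split; last first.
    move=> x [xX|xX].
    + move: xX; rewrite -{1}IH1; apply: closureS; apply: interiorS.
      by move=> y; left.
    + move: xX; rewrite -{1}IH2; apply: closureS; apply: interiorS.
      by move=> y; right.
  have cl : closed (term_val I t1 `|` term_val I t2).
    by rewrite -IH1 -IH2; apply: closedU; exact: closed_closure.
  rewrite [X in _ `<=` X](closure_id _).1//.
  by apply: closureS; exact: interior_subset.
- exact/closure_open_regclosed/open_interior.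
- apply/closure_open_regclosed/closed_openC.
  by rewrite -IH; exact: closed_closure.
Qed.

End Semantics.

(* Main.v *)
(* A cover of a normed space by four closed sets, coloured by Z/4 so that
   opposite colours are disjoint, lifts to integer levels: sum the colour changes
   along the segment from the origin; this uses that segments are compact and that
   nearby segments see the same changes. The formula asks for such a cover by
   levels, and for regions [up i], [br i], [dn i], [br' i] inside level [i], with
   connectedness and non-contact conditions which, if there are finitely many
   components, force every component of [up i] to touch [br i], every component of
   [br i] to touch [dn i], every component of [dn i] to touch [br' i], and every
   component of [br' i] to touch [up (i + 1)]. The integer level therefore
   increases without bound, so that [up 0] has infinitely many components.
   In dimension at least two the formula holds for two parallel strips cut into
   consecutive cells and joined by alternating bridges. *)
Require Import Defs.
From mathcomp Require Import all_boot all_order all_algebra.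
From mathcomp Require Import all_classical all_reals all_analysis.
From mathcomp Require Import zify lra.
Import numFieldNormedType.Exports.
Import Order.TTheory GRing.Theory Num.Theory.

Set Implicit Arguments.
Unset Strict Implicit.
Unset Printing Implicit Defensive.

Local Open Scope classical_set_scope.
Local Open Scope ring_scope.

(** * Preliminaries: connected components, and steps on the 4-cycle *)

(** If the component [K] of [x] missed [B], then [K] and the union of [B] with the other components
    would separate [X] and [B]. Finiteness enters to make the union of the other components
    closed. *)
Lemma component_meets (T : topologicalType) (X B : set T) (x : T) :
  closed X -> finitely_many_components X -> closed B -> B !=set0 ->
  connected (X `|` B) -> X x -> connected_component X x `&` B !=set0.
Proof.
move=> cX fX cB [b Bb] conn Xx; apply: contrapT => disj.
set K := connected_component X x.
pose U := \bigcup_(C in components X `\ K) C.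
have cK : closed K by exact: component_closed.
have cU : closed (U `|` B).
  apply: closedU => //; apply: closed_bigcup; first exact: finite_setD.
  by move=> C [[y Xy <-] _]; exact: component_closed.
have KUB z : K z -> ~ (U `|` B) z.
  move=> Kz [[C [[y Xy <-] /= CK] Cz]|Bz]; last by apply: disj; exists z.
  apply: CK; apply: same_connected_component.
  exact: connected_component_trans Cz (connected_component_sym Kz).
have XUB : X `|` B = K `|` (U `|` B).
  apply/seteqP; split=> z.
    case=> [Xz|Bz]; last by right; right.
    have [Kz|nKz] := pselect (K z); first by left.
    right; left; exists (connected_component X z).
      split; first by exists z.
      by move=> /= KE; apply: nKz; rewrite -KE; exact: connected_component_refl.
    exact: connected_component_refl.
  case=> [Kz|[[C [[y Xy <-] _] Cz]|Bz]]; last by right.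
  - by left; exact: connected_component_sub Kz.
  - by left; exact: connected_component_sub Cz.
have Kx : K x by exact: connected_component_refl.
have KXB : K = X `|` B.
  apply: conn; first by exists x.
    exists (~` (U `|` B)); first exact: closed_openC.
    rewrite XUB; apply/seteqP; split=> z; last by case=> -[].
    by move=> Kz; split; [left|exact: KUB].
  exists K => //; rewrite XUB; apply/seteqP; split=> z; last by case.
  by move=> Kz; split; [left|].
by apply: (KUB b); [rewrite KXB; right|right].
Qed.

Lemma locally_constant_connected (T : topologicalType) (Y : eqType)
    (A : set T) (f : T -> Y) :
  (forall x, A x -> \forall y \near x, A y -> f y = f x) ->
  connected A -> forall x y, A x -> A y -> f x = f y.
Proof.
move=> fA conA x y Ax Ay.
pose B := A `&` [set z | f z = f x].
suff : B = A by move=> /seteqP[_ /(_ _ Ay)] [].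
apply: conA; first by exists x.
  (* The implication [A z -> _] puts no condition off [A], so local constancy along [A] yields sets
     that are open in the whole space. *)
  exists (interior [set z | A z -> f z = f x]); first exact: open_interior.
  apply/seteqP; split=> z [Az]; last by move=> /interior_subset/(_ Az).
  by move=> /= fz; split=> //; rewrite -fz; exact: fA.
exists (~` interior [set z | A z -> f z <> f x]).
  exact/open_closedC/open_interior.
apply/seteqP; split=> z [Az].
  by move=> /= fz; split=> // /interior_subset/(_ Az).
move=> nz; split=> //=; apply: contrapT => fz; apply: nz.
by have := fA _ Az; apply: filterS => w /[apply] ->.
Qed.

(* The signed distance on the 4-cycle; its value on opposite colours is junk. *)
Definition cstep (a b : 'Z_4) : int :=
  match val (b - a) with 1%N => 1 | 3%N => -1 | _ => 0 end.

(** Three pairwise non-opposite colours take at most two values, which are then adjacent, and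
    between these steps add up as in the integers. *)
Lemma cstep_trans (a b c : 'Z_4) :
  b != a + 2 -> c != b + 2 -> c != a + 2 -> cstep a b + cstep b c = cstep a c.
Proof.
case: a b c => [[|[|[|[|a]]]] ?] [[|[|[|[|b]]]] ?] [[|[|[|[|c]]]] ?] //.
Qed.

Lemma cstepxx (a : 'Z_4) : cstep a a = 0.
Proof. by rewrite /cstep subrr. Qed.

Lemma cstepS (a : 'Z_4) : cstep a (a + 1) = 1.
Proof. by rewrite /cstep addrAC subrr add0r. Qed.

(** * Lifting colours modulo 4 to integer levels *)

Section Levels.
Variables (R : realType) (V : normedModType R) (L : 'Z_4 -> set V).
Hypothesis closedL : forall i, closed (L i).
Hypothesis oppL : forall i x, L i x -> ~ L (i + 2) x.

(** This is the condition under which colour steps between points of [A] are additive, as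
    [cstep_tame] records. *)
Definition tame (A : set V) :=
  forall i x y, A x -> A y -> L i x -> ~ L (i + 2) y.

Lemma tameS (A B : set V) : A `<=` B -> tame B -> tame A.
Proof. by move=> AB tB i x y /AB Bx /AB By; exact: tB. Qed.

(** For each [i], one of [L i] and [L (i + 2)] misses [x], hence by closedness misses a ball around
    it; there are only finitely many [i]. *)
Lemma ball_tame x : exists2 e : R, 0 < e & tame (ball x e).
Proof.
have loc i : \forall e \near 0^'+,
    forall y z, ball x e y -> ball x e z -> L i y -> ~ L (i + 2) z.
  have [j [ij nLj]] : exists j, (j = i \/ j = i + 2) /\ ~ L j x.
    have [Lx|nLx] := pselect (L i x).
      by exists (i + 2); split; [right|exact: oppL].
    by exists i; split; [left|].
  have : \forall y \near x, ~ L j y.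
    by apply: open_nbhs_nbhs; split=> //; exact: closed_openC.
  move=> /nbhs_ballP[e /= e0 He]; near=> d => y z xy xz Ly Lz.
  have de : ball x d `<=` ball x e by apply: le_ball; near: d; exact: nbhs_right_le.
  by case: ij => ?; subst j; [exact: (He y (de _ xy))|exact: (He z (de _ xz))].
have /filter_ex : \forall e \near (0:R)^'+, 0 < e /\ forall i, forall y z,
    ball x e y -> ball x e z -> L i y -> ~ L (i + 2) z.
  near=> e; split; first by near: e; exact: nbhs_right_gt.
  by near: e; exact: (@filter_forall _ 'Z_4).
by move=> [e [e0 He]]; exists e => // i y z; exact: He.
Unshelve. all: by end_near. Qed.

Lemma segment_tame x : exists2 e : R, 0 < e &
  forall t, 0 <= t <= 1 -> tame (ball (t *: x) e).
Proof.
have := (compact_near_coveringP `[0, 1 : R]).1 (@segment_compact R 0 1).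
move=> /(_ R (0^'+) (fun e t => tame (ball (t *: x) e)) _) H.
have /filter_ex[e [e0 He]] : \forall e \near (0:R)^'+, 0 < e /\
    (`[0, 1 : R] `<=` (fun t => tame (ball (t *: x) e))).
  near=> e; split; first by near: e; exact: nbhs_right_gt.
  near: e; apply: H => t _.
  have [e e0 te] := ball_tame (t *: x).
  (* Half of the radius at [t] pays for moving the centre from [t] to a nearby [s]; the other half
     is a radius valid at all such [s]. *)
  have e20 : 0 < e / 2 by rewrite divr_gt0.
  have Hs : \forall s \near t, ball (t *: x) (e / 2) (s *: x).
    have /cvgrPdist_lt/(_ _ e20) : s *: x @[s --> t] --> t *: x.
      by apply: cvgZr_tmp; exact: cvg_id.
    by apply: filterS => s; rewrite -ball_normE.
  near=> s d; apply: tameS te => y sy.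
  apply: (@ball_split _ _ (s *: x)); first exact: (near Hs s).
  by apply: le_ball sy; exact: (near (nbhs_right_le e20) d).
by exists e => // t t01; apply: He; rewrite /= in_itv.
Unshelve. all: by end_near. Qed.

Variable col : V -> 'Z_4.
Hypothesis colL : forall x, L (col x) x.

Lemma cstep_tame (A : set V) a b c x y z : tame A -> A x -> A y -> A z ->
  L a x -> L b y -> L c z -> cstep a b + cstep b c = cstep a c.
Proof.
move=> tA Ax Ay Az La Lb Lc; apply: cstep_trans; apply/eqP => E.
- by move: Lb; rewrite E; exact: (tA a x y).
- by move: Lc; rewrite E; exact: (tA b y z).
- by move: Lc; rewrite E; exact: (tA a x z).
Qed.

Definition dyad j k (x : V) : V := (k%:R / 2 ^+ j) *: x.

(** A discrete winding number of the colour along the segment from the origin to [x]. It is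
    meaningful once the mesh is so fine that consecutive points share a tame ball. *)
Definition dyad_sum j x : int :=
  \sum_(k < 2 ^ j) cstep (col (dyad j k x)) (col (dyad j k.+1 x)).

Lemma dyad2 j k x : dyad j.+1 k.*2 x = dyad j k x.
Proof.
rewrite /dyad exprS -mul2n natrM; congr (_ *: _).
by rewrite -mulf_div divff ?mul1r.
Qed.

Lemma dyad_end j x : dyad j (2 ^ j) x = x.
Proof. by rewrite /dyad natrX divff ?scale1r// expf_neq0. Qed.

Lemma dyad_start j x : dyad j 0 x = 0.
Proof. by rewrite /dyad mul0r scale0r. Qed.

Lemma sum_double (f : nat -> int) n :
  \sum_(k < n.*2) f k = \sum_(k < n) (f k.*2 + f k.*2.+1).
Proof.
elim: n => [|n IH]; first by rewrite !big_ord0.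
by rewrite doubleS !big_ord_recr/= IH addrA.
Qed.

Section FineMesh.
Variables (x : V) (e : R) (j : nat).
Hypothesis e0 : 0 < e.
Hypothesis te : forall t, 0 <= t <= 1 -> tame (ball (t *: x) e).
Hypothesis xj : `|x| / 2 ^+ j < e / 2.

Lemma dyad_le1 i k : (k <= 2 ^ i)%N -> 0 <= (k%:R / 2 ^+ i : R) <= 1.
Proof.
move=> ki; rewrite divr_ge0 ?exprn_ge0//= ler_pdivrMr ?exprn_gt0//.
by rewrite mul1r -natrX ler_nat.
Qed.

(** One mesh step along the segment to [x] costs less than [e / 2], and replacing [x] by [y] costs
    less than another [e / 2], since the scaling factor is at most 1. *)
Lemma dyad_ball i k l y : (j <= i)%N -> (l <= 2 ^ i)%N -> (k <= l <= k.+1)%N ->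
  ball x (e / 2) y -> ball (dyad i k x) e (dyad i l y).
Proof.
move=> ji li kl xy; apply: (@ball_split _ _ (dyad i l x)).
  rewrite -ball_normE /ball_/= /dyad -scalerBl normrZ -mulrBl normrM.
  rewrite [X in _ * X * _]ger0_norm ?invr_ge0 ?exprn_ge0//.
  have kl1 : `|k%:R - l%:R : R| <= 1.
    have [/eqP->|/eqP->] : l == k \/ l == k.+1 by lia.
      by rewrite subrr normr0.
    by rewrite distrC -natr1 addrAC subrr add0r normr1.
  rewrite -mulrA [X in _ * X]mulrC.
  apply: le_lt_trans xj; apply: (@le_trans _ _ (`|x| / 2 ^+ i)).
    by rewrite ler_piMl// divr_ge0 ?exprn_ge0.
  by rewrite ler_wpM2l// lef_pV2 ?posrE ?exprn_gt0// ler_eXn2l// ltr1n.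
rewrite -ball_normE /ball_/= /dyad -scalerBr normrZ.
move: xy; rewrite -ball_normE /ball_/= => xy; apply: le_lt_trans xy.
have /andP[l0 l1] := dyad_le1 li.
by rewrite ger0_norm// ler_piMl.
Qed.

(** Refinement inserts a midpoint in each piece; it shares a tame ball with both ends, so the two
    half steps add up to the old one. *)
Lemma dyad_sumS i : (j <= i)%N -> dyad_sum i.+1 x = dyad_sum i x.
Proof.
move=> ji; rewrite /dyad_sum.
have -> : (2 ^ i.+1 = (2 ^ i).*2)%N by rewrite expnS mul2n.
rewrite (sum_double (fun k => cstep (col (dyad i.+1 k x)) (col (dyad i.+1 k.+1 x)))).
apply: eq_bigr => k _; rewrite -doubleS !dyad2.
have xx : ball x (e / 2) x by apply: ballxx; rewrite divr_gt0.
have ki := ltn_ord k; have ki' := ltnW ki.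
apply: (cstep_tame (te (dyad_le1 ki')) _ _ _ (colL _) (colL _) (colL _)).
- by rewrite -/(dyad i k x); apply: dyad_ball; rewrite ?leqnn ?leqnSn.
- rewrite -/(dyad i k x) -dyad2; apply: dyad_ball; rewrite ?leqnn ?leqnSn//.
    exact: leqW.
  by rewrite expnS; lia.
- by rewrite -/(dyad i k x); apply: dyad_ball; rewrite ?leqnn ?leqnSn.
Qed.

Lemma dyad_sum_near i y : (j <= i)%N -> ball x (e / 2) y ->
  dyad_sum i y = dyad_sum i x + cstep (col x) (col y).
Proof.
move=> ji xy.
have xx : ball x (e / 2) x by apply: ballxx; rewrite divr_gt0.
(* The segments to [x] and [y] form a ladder: partial sums along its two sides differ by the step
   across the [m]-th rung. The bottom rung is trivial and the top one goes from [x] to [y]. *)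
have H m : (m <= 2 ^ i)%N ->
    \sum_(k < m) cstep (col (dyad i k y)) (col (dyad i k.+1 y)) =
    \sum_(k < m) cstep (col (dyad i k x)) (col (dyad i k.+1 x)) +
    cstep (col (dyad i m x)) (col (dyad i m y)).
  elim: m => [_|m IH mi].
    by rewrite !big_ord0 !dyad_start cstepxx.
  rewrite !big_ord_recr/= IH ?(ltnW mi)//.
  have t := te (dyad_le1 (ltnW mi)).
  have B l z : (m <= l <= m.+1)%N -> ball x (e / 2) z ->
      ball ((m%:R / 2 ^+ i) *: x) e (dyad i l z).
    move=> ml; apply: dyad_ball => //; apply: leq_trans mi.
    by case/andP: ml.
  have m0 : (m <= m <= m.+1)%N by rewrite leqnn leqnSn.
  have m1 : (m <= m.+1 <= m.+1)%N by rewrite leqnn leqnSn.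
  have C l z : (m <= l <= m.+1)%N -> ball x (e / 2) z ->
      cstep (col (dyad i m x)) (col (dyad i l z)) +
      cstep (col (dyad i l z)) (col (dyad i m.+1 y)) =
      cstep (col (dyad i m x)) (col (dyad i m.+1 y)).
    move=> ml xz; exact: (cstep_tame t (B m x m0 xx) (B l z ml xz) (B m.+1 y m1 xy)).
  by rewrite -!addrA !C.
by rewrite /dyad_sum H// !dyad_end.
Qed.

End FineMesh.

Lemma level_function : exists F : V -> int,
  forall x, \forall y \near x, F y = F x + cstep (col x) (col y).
Proof.
have fine x : exists ej : R * nat, [/\ 0 < ej.1,
    forall t, 0 <= t <= 1 -> tame (ball (t *: x) ej.1) &
    `|x| / 2 ^+ ej.2 < ej.1 / 2].
  have [e e0 te] := segment_tame x.
  (* An archimedean bound [j] suffices as the exponent because [j < 2 ^ j]. *)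
  have [j Hj] : exists j : nat, `|x| / (e / 2) < j%:R.
    exists (Num.bound (`|x| / (e / 2))); apply: archi_boundP.
    by rewrite !divr_ge0// ltW.
  exists (e, j); split=> //=.
  rewrite ltr_pdivrMr ?exprn_gt0// mulrC -ltr_pdivrMr ?divr_gt0//.
  apply: lt_trans Hj _; rewrite -natrX ltr_nat; exact: ltn_expl.
have [ej Hej] := choice fine.
have stable x i : ((ej x).2 <= i)%N -> dyad_sum i x = dyad_sum (ej x).2 x.
  have [e0 te xj] := Hej x.
  elim: i => [|i IH]; first by rewrite leqn0 => /eqP ->.
  rewrite leq_eqVlt => /predU1P[->//|]; rewrite ltnS => ji.
  by rewrite (dyad_sumS e0 te xj ji) IH.
exists (fun x => dyad_sum (ej x).2 x) => x; have [e0 te xj] := Hej x.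
have : \forall y \near x, ball x ((ej x).1 / 2) y.
  by apply: nbhsx_ballx; rewrite divr_gt0.
apply: filterS => y xy.
(* The meshes chosen for [x] and [y] are unrelated; the sums are compared on a common refinement. *)
pose i := maxn (ej x).2 (ej y).2.
rewrite -(stable x i) ?leq_maxl// -(stable y i) ?leq_maxr//.
exact: (dyad_sum_near e0 te xj (leq_maxl _ _) xy).
Qed.

End Levels.

(* Existence of integer levels is where simple connectedness of the ambient
   space enters. *)
Lemma Z4_cover_levels (R : realType) (V : normedModType R) (L : 'Z_4 -> set V) :
  (forall i, closed (L i)) -> (forall x, exists i, L i x) ->
  (forall i x, L i x -> ~ L (i + 2) x) ->
  exists G : 'Z_4 -> V -> int,
    (forall i A x y, A `<=` L i -> connected A -> A x -> A y -> G i x = G i y) /\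
    (forall i x, L i x -> L (i + 1) x -> G (i + 1) x = G i x + 1).
Proof.
move=> cL covL oppL; have [col colL] := choice covL.
have [F FE] := level_function cL oppL colL.
(* [F] is the level of the arbitrarily chosen colour [col x]; adding the step to [i] gives the level
   of [x] seen as a point of [L i]. *)
exists (fun i x => F x + cstep (col x) i); split=> [i A x y AL cA Ax Ay|i x Lx Lx1].
  apply: (@locally_constant_connected _ _ A (fun x => F x + cstep (col x) i)) => //.
  move=> {x y Ax Ay} x Ax.
  have [e e0 te] := ball_tame cL oppL x.
  near=> y => Ay.
  have -> : F y = F x + cstep (col x) (col y) by near: y; exact: FE.
  (* The change of [F] from [x] to [y] is offset by the change of the chosen colour. *)
  rewrite -addrA; congr (_ + _).
  apply: (cstep_tame te _ _ _ (colL x) (colL y) (AL _ Ay)).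
  - exact: ballxx.
  - by near: y; exact: nbhsx_ballx.
  - by near: y; exact: nbhsx_ballx.
have [e e0 te] := ball_tame cL oppL x.
have xx : ball x e x by exact: ballxx.
by rewrite -(cstep_tame te xx xx xx (colL x) Lx Lx1) cstepS addrA.
Unshelve. all: by end_near. Qed.

(** * The formula and its semantic form *)

Definition addT (f : nat -> term) : term :=
  Add (Add (f 0%N) (f 1%N)) (Add (f 2%N) (f 3%N)).

Definition allF (f : nat -> formula) : formula :=
  And (And (f 0%N) (f 1%N)) (And (f 2%N) (f 3%N)).

Lemma addT_val (T : topologicalType) (I : nat -> set T) f x :
  term_val I (addT f) x <-> exists i : 'Z_4, term_val I (f i) x.
Proof.
split=> /=.
  by case=> -[] fx; [exists 0|exists 1|exists 2|exists 3].
case=> -[[|[|[|[|i]]]] ?] //= fx.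
- by left; left.
- by left; right.
- by right; left.
- by right; right.
Qed.

Lemma allF_sat (T : topologicalType) (I : nat -> set T) f :
  sat I (allF f) <-> forall i : 'Z_4, sat I (f i).
Proof.
split=> /=; first by move=> [[? ?] [? ?]] [[|[|[|[|i]]]] ?].
by move=> H; split; split; [exact: (H 0)|exact: (H 1)|exact: (H 2)|exact: (H 3)].
Qed.

(* Five families of four variables, indexed cyclically by their level: the
   levels [lv] cover the space; [up] and [dn] are two parallel strips, cut into
   pieces; each [br i] bridges [up i] and [dn i], and each [br' i] bridges
   [dn i] and [up (i + 1)]. *)
Definition lv i := Var i.
Definition up i := Var (4 + i).
Definition dn i := Var (8 + i).
Definition br i := Var (12 + i).
Definition br' i := Var (16 + i).

Definition Sub s t := Eq (Add s t) t.
Definition Disj s t := Not (Contact s t).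
Definition Triv := Eq Zero Zero.

(** Each [Conn] joins a region to a sum, which the components of the region must then reach; the
    non-contact conditions single out the summands that they can meet. *)
Definition inf_formula : formula :=
  And (And (Eq (addT lv) One)
      (And (allF (fun i => Disj (lv i) (lv ((i + 2) %% 4))))
      (And (Not (Eq (up 0) Zero)) (Not (Eq (dn 0) Zero)))))
 (And (Disj (addT up) (addT dn))
      (allF (fun i =>
        And (And (Sub (up i) (lv i)) (And (Sub (dn i) (lv i))
            (And (Sub (br i) (lv i)) (Sub (br' i) (lv i)))))
       (And (allF (fun j => if j == i then Triv else Disj (br i) (dn j)))
       (And (allF (fun j =>
              if j == (i + 1) %% 4 then Triv else Disj (br' i) (up j)))
       (And (And (Conn (Add (br i) (addT dn))) (Conn (Add (br' i) (addT up))))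
            (And (Conn (Add (up i) (Add (br i) (addT dn))))
                 (Conn (Add (dn i) (Add (br' i) (addT up)))))))))))%N.

Definition is_inf_family (T : topologicalType) (L U D B B' : 'Z_4 -> set T) :=
  [/\ [/\ forall x, exists i, L i x, forall i x, L i x -> ~ L (i + 2) x,
          U 0 !=set0 & D 0 !=set0],
      forall i j x, U i x -> ~ D j x,
      forall i, [/\ U i `<=` L i, D i `<=` L i, B i `<=` L i & B' i `<=` L i],
      (forall i j x, B i x -> D j x -> j = i) /\
      (forall i j x, B' i x -> U j x -> j = i + 1) &
      forall i, [/\ connected (B i `|` \bigcup_j D j),
        connected (B' i `|` \bigcup_j U j),
        connected (U i `|` (B i `|` \bigcup_j D j)) &
        connected (D i `|` (B' i `|` \bigcup_j U j))]].

Lemma inf_formula_sat (T : topologicalType) (I : nat -> set T) :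
  sat I inf_formula <->
  is_inf_family (fun i : 'Z_4 => I i) (fun i : 'Z_4 => I (4 + i)%N)
    (fun i : 'Z_4 => I (8 + i)%N) (fun i : 'Z_4 => I (12 + i)%N)
    (fun i : 'Z_4 => I (16 + i)%N).
Proof.
have addE f : term_val I (addT f) = \bigcup_(i : 'Z_4) term_val I (f i).
  apply/seteqP; split=> x.
    by move=> /addT_val[i fx]; exists i.
  by move=> [i _ fx]; apply/addT_val; exists i.
have subE (X Y : set T) : X `|` Y = Y <-> X `<=` Y.
  by split=> [<- x|/setUidPr]; [left|].
have disjE (X Y : set T) : ~ (X `&` Y !=set0) <-> forall x, X x -> ~ Y x.
  split=> [XY x Xx Yx|XY [x [/XY]]//]; by apply: XY; exists x.
have neE (X : set T) : X <> set0 <-> X !=set0.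
  by split=> [/eqP/set0P|/set0P/eqP].
(* The remainders modulo 4 written in the formula are addition in ['Z_4] by computation. *)
have addv (i j : 'Z_4) : ((i + j)%R = (i + j) %% 4 :> nat)%N by [].
have andE f g : sat I (And f g) <-> sat I f /\ sat I g by [].
split.
  move=> /andE[/andE[cov /andE[/allF_sat opp /andE[u0 d0]]] /andE[ud /allF_sat all]].
  split; first split.
  - by move=> x; apply/(addT_val I lv); rewrite [term_val _ _]cov.
  - by move=> i; rewrite addv; apply/disjE; exact: opp.
  - exact/neE.
  - exact/neE.
  - move=> i j x Ux Dx; apply: ud; exists x.
    by split; [apply/(addT_val I up); exists i|apply/(addT_val I dn); exists j].
  - move=> i; have /andE[/andE[s1 /andE[s2 /andE[s3 s4]]] _] := all i.
    by split; exact/subE.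
  - split=> i j x; have /andE[_ /andE[/allF_sat bd /andE[/allF_sat bu _]]] := all i.
      move=> Bx Dx; apply: contrapT => /eqP ji; move: (bd j).
      by rewrite ifN// => /disjE/(_ _ Bx Dx).
    move=> Bx Ux; apply: contrapT => /eqP ji; move: (bu j).
    by rewrite ifN// => /disjE/(_ _ Bx Ux).
  - move=> i; have /andE[_ /andE[_ /andE[_ /andE[/andE[c1 c2] /andE[c3 c4]]]]] := all i.
    by rewrite -(addE dn) -(addE up).
move=> [[cov opp u0 d0] ud sub [bd bu] conn]; apply/andE; split.
  apply/andE; split.
    by apply/seteqP; split=> x // _; apply/(addT_val I lv); exact: cov.
  apply/andE; split; last by split; exact/neE.
  by apply/allF_sat => i; apply/disjE; have := opp i; rewrite addv.
apply/andE; split.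
  by apply/disjE => x /addT_val[i Ux] /addT_val[j]; exact: ud Ux.
apply/allF_sat => i; apply/andE; split.
  by have [? ? ? ?] := sub i; do ![split]; exact/subE.
apply/andE; split; last apply/andE; last split.
- apply/allF_sat => j; case: ifPn => // ji; apply/disjE => x Bx Dx.
  by move: ji; rewrite (bd _ _ _ Bx Dx) eqxx.
- apply/allF_sat => j; case: ifPn => // ji; apply/disjE => x Bx Ux.
  by move: ji; rewrite (bu _ _ _ Bx Ux) addv eqxx.
- have [c1 c2 c3 c4] := conn i.
  by rewrite -(addE dn) -(addE up) in c1 c2 c3 c4.
Qed.

(** * Finitely many components are impossible *)

(** One pass through [U i], [B i], [D i], [B' i] to [U (i + 1)] raises the level by 1, so the level
    is unbounded on [U 0]. Yet it is constant on each of the finitely many components of [U 0]. *)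
Lemma inf_family_infinite (R : realType) (V : normedModType R)
    (L U D B B' : 'Z_4 -> set V) :
  is_inf_family L U D B B' ->
  (forall i, [/\ closed (L i), closed (U i), closed (D i), closed (B i) &
     closed (B' i)]) ->
  (forall i, [/\ finitely_many_components (U i), finitely_many_components (D i),
     finitely_many_components (B i) & finitely_many_components (B' i)]) ->
  False.
Proof.
move=> [[cov opp [u0 Uu0] [d0 Dd0]] UD sub [BD B'U] conn] cl fin.
have cL i : closed (L i) by case: (cl i).
have [G [Gconst GS]] := Z4_cover_levels cL cov opp.
(* The new point is taken in the same component of [X], hence has the same level. *)
have move_on i X Y x : X `<=` L i -> closed X -> finitely_many_components X ->
    closed Y -> Y !=set0 -> connected (X `|` Y) -> X x ->
    exists y, [/\ X y, Y y & G i y = G i x].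
  move=> XL cX fX cY Y0 XY Xx.
  have [y [Ky Yy]] := component_meets cX fX cY Y0 XY Xx.
  exists y; split=> //; first exact: connected_component_sub Ky.
  apply: (Gconst i (connected_component X x)) => //.
  - by apply: subset_trans XL; exact: connected_component_sub.
  - exact: component_connected.
  - exact: connected_component_refl.
have cUU : closed (\bigcup_j U j).
  by apply: closed_bigcup => [|j _]; [exact: finite_finset|case: (cl j)].
have cDD : closed (\bigcup_j D j).
  by apply: closed_bigcup => [|j _]; [exact: finite_finset|case: (cl j)].
have UU0 : \bigcup_j U j !=set0 by exists u0, 0.
have DD0 : \bigcup_j D j !=set0 by exists d0, 0.
have next i x : U i x -> exists y, U (i + 1) y /\ G (i + 1) y = G i x + 1.
  have [_ cU cD cB cB'] := cl i; have [fU fD fB fB'] := fin i.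
  have [sU sD sB sB'] := sub i; have [c1 c2 c3 c4] := conn i.
  move=> Ux.
  have [y [Uy By Gy]] : exists y, [/\ U i y, B i y & G i y = G i x].
    have [||y [Uy [By|[j _ Dy]] Gy]] := move_on i _ _ x sU cU fU _ _ c3 Ux.
    - exact: closedU.
    - by case: DD0 => d; exists d; right.
    - by exists y.
    - by have := UD _ _ _ Uy Dy.
  have [z [Bz Dz Gz]] : exists z, [/\ B i z, D i z & G i z = G i y].
    have [z [Bz [j _ Dz] Gz]] := move_on i _ _ y sB cB fB cDD DD0 c1 By.
    by exists z; split=> //; rewrite -(BD _ _ _ Bz Dz).
  have [w [Dw B'w Gw]] : exists w, [/\ D i w, B' i w & G i w = G i z].
    have [||w [Dw [Bw|[j _ Uw]] Gw]] := move_on i _ _ z sD cD fD _ _ c4 Dz.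
    - exact: closedU.
    - by case: UU0 => d; exists d; right.
    - by exists w.
    - by have := UD _ _ _ Uw Dw.
  have [v [B'v [j _ Uv] Gv]] := move_on i _ _ w sB' cB' fB' cUU UU0 c2 B'w.
  have ji := B'U _ _ _ B'v Uv; rewrite ji in Uv.
  (* The level rises only here, where [v] lies in both [L i] and [L (i + 1)]. *)
  exists v; split=> //; rewrite GS ?Gv ?Gw ?Gz ?Gy//; first exact: sB'.
  by have [+ _ _ _] := sub (i + 1); apply.
(* Four passes return to index 0 and gain 4 levels; the weaker gain of 1 is enough. *)
have high (n : nat) : exists2 x, U 0 x & G 0 x >= n%:Z + G 0 u0.
  elim: n => [|n [x Ux Gx]]; first by exists u0; rewrite ?add0r.
  have [y [Uy Gy]] := next _ _ Ux.
  have [z [Uz Gz]] := next _ _ Uy.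
  have [w [Uw Gw]] := next _ _ Uz.
  have [v [Uv Gv]] := next _ _ Uw.
  have E : 0 + 1 + 1 + 1 + 1 = 0 :> 'Z_4 by apply/val_inj.
  rewrite E in Uv Gv.
  by exists v => //; rewrite Gv Gw Gz Gy; lia.
have [fU0 _ _ _] := fin 0; have [sU0 _ _ _] := sub 0.
have Gset : finite_set (G 0 @` U 0).
  (* Each component is sent to the level of a chosen point; the default of [xget] never occurs, as
     components of points are nonempty. *)
  apply: (sub_finite_set _ (finite_image (fun C => G 0 (xget 0 C)) fU0)).
  move=> _ [x Ux <-]; exists (connected_component (U 0) x); first by exists x.
  apply: (Gconst 0 (connected_component (U 0) x)).
  - by apply: subset_trans sU0; exact: connected_component_sub.
  - exact: component_connected.
  - apply: xgetPex; exists x; exact: connected_component_refl.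
  - exact: connected_component_refl.
have [M HM] : exists M : int, forall x, U 0 x -> G 0 x <= M.
  move/finite_seqP: Gset => [s Hs].
  exists (\sum_(z <- s) `|z|) => x Ux.
  have xs : G 0 x \in s.
    have : (G 0 @` U 0) (G 0 x) by exists x.
    by rewrite Hs.
  apply: le_trans (ler_norm _) _.
  rewrite (big_rem _ xs)/= lerDl sumr_ge0// => *; exact: normr_ge0.
have [x Ux] := high (absz (M - G 0 u0 + 1)).
have := HM _ Ux; lia.
Qed.

(** * Regular closed and connected sets, for use in the model *)

Lemma regclosedP (T : topologicalType) (A : set T) :
  closed A -> A `<=` closure A° -> regclosed A.
Proof.
move=> cA AA; apply/seteqP; split=> //.
by rewrite [X in _ `<=` X](closure_id A).1//; apply: closureS; exact: interior_subset.
Qed.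

Lemma regclosed_closed (T : topologicalType) (A : set T) : regclosed A -> closed A.
Proof. by move=> <-; exact: closed_closure. Qed.

Lemma connected_bigcupU (T : topologicalType) (J : Type) (C : J -> set T) (Y : set T) :
  connected Y -> (forall j, connected (C j)) -> (forall j, C j `&` Y !=set0) ->
  connected ((\bigcup_j C j) `|` Y).
Proof.
move=> cY cC CY; have [[y Yy]|/nonemptyPn Y0] := pselect (Y !=set0); last first.
  rewrite Y0 setU0 (_ : \bigcup_j C j = set0); first exact: connected0.
  by apply/seteqP; split=> // x [j]; have := CY j; rewrite Y0 setI0 => -[].
(* The extra index [None] contributes [Y] itself, which covers the case of empty [J]. *)
rewrite (_ : _ `|` _ = \bigcup_(o : option J) (if o is Some j then C j `|` Y else Y)).
  apply: bigcup_connected; first by exists y => -[j|] _ //; right.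
  by move=> [j|] _ //; exact: connectedU.
apply/seteqP; split=> x.
  by case=> [[j _ Cx]|Yx]; [exists (Some j) => //; left|exists None].
by case=> -[j|] _; [case=> [Cx|]; [left; exists j|right]|right].
Qed.

Lemma convex_connected (R : realType) (V : normedModType R) (A : set V) :
  (forall x y t, A x -> A y -> 0 <= t <= 1 -> A (x + t *: (y - x))) ->
  connected A.
Proof.
move=> cvA; have [[x Ax]|/nonemptyPn ->] := pselect (A !=set0); last exact: connected0.
pose seg y : set V := (fun t : R => x + t *: (y - x)) @` `[0, 1].
have -> : A = \bigcup_(y in A) seg y.
  apply/seteqP; split=> y.
    move=> Ay; exists y => //; exists 1; first by rewrite /= in_itv/= ler01 lexx.
    by rewrite scale1r addrC subrK.
  by move=> [z Az [t /=]]; rewrite in_itv/= => t01 <-; exact: cvA.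
apply: bigcup_connected.
  by exists x => y _; exists 0; rewrite /= ?in_itv/= ?ler01 ?lexx// scale0r addr0.
move=> y _; apply: connected_continuous_connected; first exact: segment_connected.
apply: continuous_subspaceT => t; apply: cvgD; first exact: cvg_cst.
by apply: cvgZr_tmp; exact: cvg_id.
Qed.

(** * The model in dimension at least two *)

Section Model.
Variables (R : realType) (m : nat).
Local Notation V := 'rV[R]_m.+2.
Implicit Types (a b c d : R) (A J : set R).

Definition periodic a b : set R :=
  [set x | exists q : int, a + 4 * q%:~R <= x <= b + 4 * q%:~R].

Lemma regclosed_seg a b : a < b -> regclosed `[a, b].
Proof.
move=> ab; apply: regclosedP; first exact: itv_closed.
move=> x /=; rewrite in_itv/= => /andP[ax xb].
rewrite interior_itv_bnd => B /nbhs_ballP[e /= e0 xB].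
(* A point of the open interval near [x] is found by moving [x] towards the midpoint. *)
pose h := Num.min (e / 2) ((b - a) / 2).
have h0 : 0 < h by rewrite lt_min !divr_gt0// subr_gt0.
have he : h <= e / 2 by rewrite ge_min lexx.
have hab : h <= (b - a) / 2 by rewrite ge_min lexx orbT.
have [xm|xm] := leP x ((a + b) / 2).
  exists (x + h / 2); split; first by rewrite /= in_itv/=; apply/andP; split; lra.
  by apply: xB; rewrite /ball/= opprD addrA subrr sub0r normrN gtr0_norm; lra.
exists (x - h / 2); split; first by rewrite /= in_itv/=; apply/andP; split; lra.
by apply: xB; rewrite /ball/= opprB addrC subrK gtr0_norm; lra.
Qed.

Lemma regclosed_periodic a b : a < b < a + 4 -> regclosed (periodic a b).
Proof.
move=> /andP[ab ba]; apply: regclosedP.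
  rewrite -openC openE => x nx.
  (* The [k]-th translate is the last one starting at or before [x], so [x] lies in the gap before
     the next. *)
  pose k := Num.floor ((x - a) / 4).
  have := floor_itv ((x - a) / 4); rewrite -/k => /andP[k1 k2].
  have k1' : a + 4 * k%:~R <= x by lra.
  have k2' : x < a + 4 * (k + 1)%:~R by lra.
  have xb : b + 4 * k%:~R < x.
    by rewrite ltNge; apply/negP => xb; apply: nx; exists k; rewrite k1' xb.
  apply: (@filterS _ _ _ `](b + 4 * k%:~R), (a + 4 * (k + 1)%:~R)[).
    move=> y /=; rewrite in_itv/= => /andP[y1 y2] [q /andP[q1 q2]].
    have : k%:~R < q%:~R :> R by lra.
    have : q%:~R < (k + 1)%:~R :> R by lra.
    by rewrite !ltr_int; lia.
  by apply: near_in_itv; rewrite in_itv/= xb k2'.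
move=> x [q qx].
have abq : a + 4 * q%:~R < b + 4 * q%:~R by rewrite ltrD2r.
have /seteqP[_ /(_ x)] := regclosed_seg abq.
rewrite /= in_itv/= => /(_ qx); apply: closureS; apply: interiorS.
by move=> y /=; rewrite in_itv => ?; exists q.
Qed.

(** Leaving all further coordinates free makes the model uniform in the dimension. *)
Definition box A J : set V := [set v | A (v 0 0) /\ J (v 0 1)].

Lemma regclosed_box A J : regclosed A -> regclosed J -> regclosed (box A J).
Proof.
move=> rA rJ.
have coord i : continuous (fun v : V => v 0 i) by exact: coord_continuous.
apply: regclosedP.
  have -> : box A J = (fun v : V => v 0 0) @^-1` A `&` (fun v : V => v 0 1) @^-1` J by [].
  apply: closedI; apply: closed_comp => [v _|]; rewrite ?coord//;
    exact: regclosed_closed.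
move=> v [Av Jv] B /nbhs_ballP[e /= e0 vB].
have {}Av : closure A° (v 0 0) by rewrite rA.
have {}Jv : closure J° (v 0 1) by rewrite rJ.
have [a [Aa va]] := Av _ (nbhsx_ballx _ _ e0).
have [b [Jb vb]] := Jv _ (nbhsx_ballx _ _ e0).
exists (\row_j if j == 0 then a else if j == 1 then b else v 0 j); split.
  apply: (@filterS _ _ _ ((fun v : V => v 0 0) @^-1` A `&`
                          (fun v : V => v 0 1) @^-1` J)) => //.
  by apply: filterI; apply: coord; rewrite mxE.
apply: vB; split=> // i j; rewrite mxE ord1.
case: eqP => [->//|_]; case: eqP => [->//|_]; exact: ballxx.
Qed.

Definition point a b : V := \row_j if j == 0 then a else b.

Lemma point0 a b : point a b 0 0 = a. Proof. by rewrite mxE. Qed.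
Lemma point1 a b : point a b 0 1 = b. Proof. by rewrite mxE. Qed.

Lemma box_connected A J : is_interval A -> is_interval J -> connected (box A J).
Proof.
have H (X : set R) (x y t : R) : is_interval X -> X x -> X y -> 0 <= t <= 1 ->
    X (x + t * (y - x)).
  move=> iX Xx Xy /andP[t0 t1]; have [xy|/ltW yx] := leP x y.
    by apply: (iX x y) => //; apply/andP; split; nra.
  by apply: (iX y x) => //; apply/andP; split; nra.
move=> iA iJ; apply: convex_connected => v w t [Av Jv] [Aw Jw] t01.
by split; rewrite !mxE; exact: H.
Qed.

Definition stripes (i : 'Z_4) a b J : set V :=
  box (periodic ((i : nat)%:R + a) ((i : nat)%:R + b)) J.

Lemma regclosed_stripes i a b J : a < b < a + 4 -> regclosed J ->
  regclosed (stripes i a b J).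
Proof.
move=> ab rJ; apply: regclosed_box => //; apply: regclosed_periodic.
by rewrite -addrA !ltrD2l.
Qed.

Definition cell (i : 'Z_4) a b J (q : int) : set V :=
  box `[(i : nat)%:R + a + 4 * q%:~R, (i : nat)%:R + b + 4 * q%:~R] J.

Lemma stripesE i a b J : stripes i a b J = \bigcup_q cell i a b J q.
Proof.
apply/seteqP; split=> v.
  by move=> [[q qv] Jv]; exists q => //; split=> //=; rewrite in_itv.
by move=> [q _ [/=]]; rewrite in_itv/= => qv Jv; split=> //; exists q.
Qed.

Lemma cell_connected i a b J q : is_interval J -> connected (cell i a b J q).
Proof. by apply: box_connected; exact: interval_is_interval. Qed.

Lemma stripesS i a b c d J K : c <= a -> b <= d -> J `<=` K ->
  stripes i a b J `<=` stripes i c d K.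
Proof.
move=> ca bd JK v [[q /andP[q1 q2]] Jv]; split; last exact: JK.
by exists q; apply/andP; split; lra.
Qed.

(** The first coordinate of [v] confines the offset [k] between the two translates containing it;
    modulo 4, this offset is the difference of the indices. *)
Lemma stripes_meet i j a b c d J K v :
  stripes i a b J v -> stripes j c d K v ->
  exists2 k : int, a - d <= k%:~R <= b - c & j = i + k%:~R.
Proof.
move=> [[q /andP[q1 q2]] _] [[p /andP[p1 p2]] _].
exists ((j : nat)%:Z + 4%:Z * p - ((i : nat)%:Z + 4%:Z * q)).
  by rewrite !(rmorphB, rmorphD, rmorphM)/= -!pmulrn; apply/andP; split; lra.
have Z40 : 4%:~R = 0 :> 'Z_4 by apply/val_inj.
rewrite !(rmorphB, rmorphD, rmorphM)/= Z40 !mul0r !addr0 -!pmulrn !natr_Zp.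
by rewrite addrC subrK.
Qed.

Lemma stripes_cover a J (v : V) : J (v 0 1) -> exists i, stripes i a (a + 1) J v.
Proof.
(* The remainder of [k] modulo 4 is the index, the quotient the translate. *)
move=> Jv; pose k := Num.floor (v 0 0 - a).
have k4 : (absz (k %% 4)%Z < 4)%N by lia.
exists (Ordinal k4); split=> //; exists (k %/ 4)%Z.
have kE : k%:~R = (absz (k %% 4)%Z)%:R + 4 * (k %/ 4)%Z%:~R :> R.
  have {1}-> : k = (absz (k %% 4)%Z)%:Z + 4%:Z * (k %/ 4)%Z by lia.
  by rewrite rmorphD rmorphM/= -!pmulrn.
have /andP[] := floor_itv (v 0 0 - a); rewrite -/k rmorphD/= kE => k1 k2.
by apply/andP; split; lra.
Qed.

Lemma bigcup_stripes a J : \bigcup_i stripes i a (a + 1) J = box setT J.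
Proof.
apply/seteqP; split=> v; first by move=> [i _ []].
by move=> [_ /(stripes_cover a)[i iv]]; exists i.
Qed.

(** Levels of length 3/2 overlap their neighbours but not their opposites. The lower strip is
    shifted by 1/2, so a bridge over the second half of a cell of [model_up i] sees only
    [model_dn i], and one over the next half unit joins [model_dn i] to [model_up (i + 1)]. *)
Definition model_lv i := stripes i 0 (3 / 2) setT.
Definition model_up i := stripes i 0 (0 + 1) `[1, 2].
Definition model_dn i := stripes i (1 / 2) (1 / 2 + 1) `[-1, 0].
Definition model_br i := stripes i (3 / 5) (9 / 10) `[0, 1].
Definition model_br' i := stripes i (11 / 10) (7 / 5) `[0, 1].

Lemma point_box a b A J : A a -> J b -> box A J (point a b).
Proof. by move=> Aa Jb; split; rewrite ?point0 ?point1. Qed.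

Lemma small_int (k : int) (l u : int) :
  l%:~R - 1 < k%:~R :> R -> k%:~R < u%:~R + 1 :> R -> l <= k <= u.
Proof.
rewrite ltrBlDr -[1 in X in X -> _]/(1%:~R) -[1 in X in _ -> X -> _]/(1%:~R).
by rewrite -!rmorphD/= !ltr_int; lia.
Qed.

Lemma model_inf_family :
  is_inf_family model_lv model_up model_dn model_br model_br'.
Proof.
have UE : \bigcup_j model_up j = box setT `[1, 2] by exact: bigcup_stripes.
have DE : \bigcup_j model_dn j = box setT `[-1, 0] by exact: bigcup_stripes.
have iT : is_interval [set: R] by [].
have ii c d : is_interval `[c, d] by exact: interval_is_interval.
have cU : connected (box setT `[1, 2]) by exact: box_connected.
have cD : connected (box setT `[-1, 0]) by exact: box_connected.
have cB i : connected (model_br i `|` box setT `[-1, 0]).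
  rewrite /model_br stripesE; apply: connected_bigcupU => // q.
    exact: cell_connected.
  exists (point ((i : nat)%:R + 3 / 5 + 4 * q%:~R) 0).
  by split; apply: point_box; rewrite //= in_itv/=; lra.
have cB' i : connected (model_br' i `|` box setT `[1, 2]).
  rewrite /model_br' stripesE; apply: connected_bigcupU => // q.
    exact: cell_connected.
  exists (point ((i : nat)%:R + 11 / 10 + 4 * q%:~R) 1).
  by split; apply: point_box; rewrite //= in_itv/=; lra.
split.
- split.
  + move=> v; have [i iv] := @stripes_cover 0 setT v I.
    by exists i; apply: stripesS iv => //; lra.
  + move=> i v iv i2v; have [k /andP[k1 k2]] := stripes_meet iv i2v.
    (* Meeting levels have offset at most 1 in absolute value, which is never 2 modulo 4. *)
    have /andP[k1' k2'] : -1 <= k <= 1 by apply: small_int; lra.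
    have : k = -1 \/ k = 0 \/ k = 1 by lia.
    move=> E /addrI; case: E => [->|[->|->]] /(congr1 val); by [].
  + exists (point 0 1); apply: point_box; last by rewrite /= in_itv/=; lra.
    by exists 0; rewrite /=; lra.
  + exists (point 1 0); apply: point_box; last by rewrite /= in_itv/=; lra.
    by exists 0; rewrite /=; lra.
- move=> i j v [_ /=]; rewrite in_itv/= => v1 [_ /=]; rewrite in_itv/=; lra.
- by move=> i; split; apply: stripesS => //; lra.
- split=> i j v iv jv; have [k /andP[k1 k2] ->] := stripes_meet iv jv.
    have /andP[k1' k2'] : 0 <= k <= 0 by apply: small_int; lra.
    have -> : k = 0 by lia.
    by rewrite addr0.
  have /andP[k1' k2'] : 1 <= k <= 1 by apply: small_int; lra.
  have -> : k = 1 by lia.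
  by [].
- move=> i; rewrite UE DE; split=> //.
    rewrite {1}/model_up stripesE; apply: connected_bigcupU => // q.
      exact: cell_connected.
    (* The top left corner of the bridge, lying on the lower edge of the cell of [model_up i]. *)
    exists (point ((i : nat)%:R + 3 / 5 + 4 * q%:~R) 1); split.
      by apply: point_box; rewrite //= in_itv/=; lra.
    left; rewrite /model_br stripesE; exists q => //.
    by apply: point_box; rewrite //= in_itv/=; lra.
  rewrite {1}/model_dn stripesE; apply: connected_bigcupU => // q.
    exact: cell_connected.
  exists (point ((i : nat)%:R + 11 / 10 + 4 * q%:~R) 0); split.
    by apply: point_box; rewrite //= in_itv/=; lra.
  left; rewrite /model_br' stripesE; exists q => //.
  by apply: point_box; rewrite //= in_itv/=; lra.
Qed.

(** This decodes the numbering of variables in blocks of four; all variables from 16 on receive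
    bridges of the last kind. *)
Definition model (n : nat) : set V :=
  let i : 'Z_4 := inZp n in
  match (n %/ 4)%N with
  | 0%N => model_lv i | 1%N => model_up i | 2%N => model_dn i
  | 3%N => model_br i | _ => model_br' i
  end.

Lemma model_interpretation : interpretation model.
Proof.
move=> n; rewrite /RC/= /model.
have rT : regclosed [set: R] by rewrite /regclosed interiorT closureT.
have rS c d : c < d -> regclosed `[c, d] by exact: regclosed_seg.
case: (n %/ 4)%N => [|[|[|[|?]]]]; apply: regclosed_stripes => //;
  by [apply: rS; lra|apply/andP; split; lra].
Qed.

Lemma inf_formula_satisfiable : satisfiable V inf_formula.
Proof.
exists model; split; first exact: model_interpretation.
apply/inf_formula_sat.
have modelE k l (i : 'Z_4) : (l = 4 * k)%N -> model (l + i)%N =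
    match k with
    | 0%N => model_lv i | 1%N => model_up i | 2%N => model_dn i
    | 3%N => model_br i | _ => model_br' i
    end.
  move=> ->; rewrite /model.
  have -> : ((4 * k + i) %/ 4 = k)%N by have i4 : (i < 4)%N := ltn_ord i; lia.
  have -> // : inZp (4 * k + i)%N = i :> 'Z_4.
  by apply/val_inj; rewrite [LHS]/= mulnC (modnMDl k i 4) modn_small.
have -> : (fun i : 'Z_4 => model i) = model_lv.
  by apply/funext => i; rewrite -[in LHS](add0n i) (modelE 0%N).
have -> : (fun i : 'Z_4 => model (4 + i)%N) = model_up.
  by apply/funext => i; rewrite (modelE 1%N).
have -> : (fun i : 'Z_4 => model (8 + i)%N) = model_dn.
  by apply/funext => i; rewrite (modelE 2%N).
have -> : (fun i : 'Z_4 => model (12 + i)%N) = model_br.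
  by apply/funext => i; rewrite (modelE 3%N).
have -> : (fun i : 'Z_4 => model (16 + i)%N) = model_br'.
  by apply/funext => i; rewrite (modelE 4%N).
exact: model_inf_family.
Qed.

End Model.

Theorem theorem1 (R : realType) :
  exists phi : formula, forall n : nat, (2 <= n)%N ->
    satisfiable 'rV[R]_n phi /\
    ~ (exists I : nat -> set 'rV[R]_n,
         [/\ interpretation I,
             forall i, finitely_many_components (I i)
           & sat I phi]).
Proof.
exists inf_formula => -[|[|m]] // _; split; first exact: inf_formula_satisfiable.
move=> [I [RCI fin /inf_formula_sat fam]].
apply: (inf_family_infinite fam) => i; last by split; exact: fin.
by split; exact: regclosed_closed (RCI _).
Qed.
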